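(* Let $f \colon \mathbb{R}^d \to [0,+\infty)$ be a proper log-concave function such that $\hbar$ is the John function of $f$ with respect to $\hbar$. Then \[ \hbar \leq f \quad\text{and}\quad e^{-(d+1)}\, \hbar\big((d+1)x\big) \leq f^{\circ}(x) \ \text{ for all } x\in\mathbb{R}^d, \] where $f^\circ$ is the polar function of $f$.
   Context: A function $f\colon\mathbb{R}^d\to[0,\infty)$ is called proper log-concave if it is upper semi-continuous, log-concave, and has finite positive integral. For functions $f_1,f_2$ on $\mathbb{R}^d$, $f_1\le f_2$ means $f_1(x)\le f_2(x)$ for all $x$. The height function is $\hbar(x)=\sqrt{1-|x|^2}$ for $x$ in the closed Euclidean unit ball $\mathbf{B}^d$ and $\hbar(x)=0$ otherwise. The positions of a function $w$ are the functions $\alpha\, w(Ax+a)$ with $A$ a non-singular $d\times d$ real matrix, $\alpha>0$, $a\in\mathbb{R}^d$. The John function of $f$ with respect to $w$ is a position $g$ of $w$ maximizing $\int_{\mathbb{R}^d} g$ subject to $g\le f$; thus ''$\hbar$ is the John function of $f$ with respect to $\hbar$'' means $\hbar\le f$ and $\int g\le\int\hbar$ for every position $g$ of $\hbar$ with $g\le f$. The polar function of a non-negative function $f$ is $f^\circ(p)=\inf_{\{x: f(x)>0\}} \frac{e^{-\langle p,x\rangle}}{f(x)}$. *)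

(* Defs.v *)
From HB Require Import structures.
From mathcomp Require Import all_boot all_order all_algebra.
From mathcomp Require Import all_classical all_reals all_analysis.
Set Implicit Arguments. Unset Strict Implicit. Unset Printing Implicit Defensive.
Import Order.TTheory GRing.Theory Num.Theory.
Import numFieldNormedType.Exports.
Local Open Scope classical_set_scope.
Local Open Scope ring_scope.

Section Defs.
Variable R : realType.

Definition dotv (d : nat) (p x : 'rV[R]_d) : R := \sum_(i < d) p ord0 i * x ord0 i.
Definition sqnorm (d : nat) (x : 'rV[R]_d) : R := dotv x x.

(* Lebesgue integral over R^d of a non-negative function, computed as the
   iterated one-dimensional Lebesgue integral (Tonelli). *)
Fixpoint iint (d : nat) : ('rV[R]_d -> \bar R) -> \bar R :=
  match d return ('rV[R]_d -> \bar R) -> \bar R with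
  | 0 => fun f => f 0
  | d'.+1 => fun f =>
      (\int[@lebesgue_measure R]_(t in [set: R])
         iint (fun y : 'rV[R]_d' => f (row_mx (\row_(j < 1) t) y)))%E
  end.

Definition integral_Rd (d : nat) (f : 'rV[R]_d -> R) : \bar R :=
  iint (fun x => (f x)%:E).

Definition upper_semicontinuous (d : nat) (f : 'rV[R]_d -> R) : Prop :=
  forall x t, f x < t -> \forall y \near x, f y < t.

Definition log_concave (d : nat) (f : 'rV[R]_d -> R) : Prop :=
  forall (x y : 'rV[R]_d) (l : R), 0 <= l <= 1 ->
    f x `^ (1 - l) * f y `^ l <= f ((1 - l) *: x + l *: y).

Definition proper_log_concave (d : nat) (f : 'rV[R]_d -> R) : Prop :=
  [/\ forall x, 0 <= f x,
      upper_semicontinuous f,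
      log_concave f &
      (0 < integral_Rd f < +oo)%E].

(* height function of the Euclidean unit ball *)
Definition hbar (d : nat) (x : 'rV[R]_d) : R :=
  if sqnorm x <= 1 then Num.sqrt (1 - sqnorm x) else 0.

Definition position (d : nat) (w : 'rV[R]_d -> R) (A : 'M[R]_d) (alpha : R)
  (a : 'rV[R]_d) : 'rV[R]_d -> R :=
  fun x => alpha * w (x *m A + a).

Definition fle (d : nat) (f1 f2 : 'rV[R]_d -> R) : Prop := forall x, f1 x <= f2 x.

Definition hbar_is_John_function (d : nat) (f : 'rV[R]_d -> R) : Prop :=
  fle (@hbar d) f /\
  forall (A : 'M[R]_d) (alpha : R) (a : 'rV[R]_d),
    A \in unitmx -> 0 < alpha -> fle (position (@hbar d) A alpha a) f ->
    (integral_Rd (position (@hbar d) A alpha a) <= integral_Rd (@hbar d))%E.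

Definition polar (d : nat) (f : 'rV[R]_d -> R) (p : 'rV[R]_d) : R :=
  inf [set expR (- dotv p x) / f x | x in [set x | 0 < f x]].

End Defs.

(* Main.v *)
Require Import Defs.
From HB Require Import structures.
From mathcomp Require Import all_boot all_order all_algebra.
From mathcomp Require Import all_classical all_reals all_analysis.
From mathcomp Require Import measurable_realfun ring lra.
Import Order.TTheory GRing.Theory Num.Theory.
Local Open Scope ring_scope.

(** By log-concavity, f dominates the log-concave hull of hbar and any one
    point (y, f y). If f y violates the bound, this hull leaves room to enlarge
    hbar. With L = ln (f y) and |q| <= 1, move each z of the unit ball towards y
    by the fraction e (s + <q,z>), so that up to O(e^2) the base point becomes
      z - e (s z + q) + e (s + <q,z>) y.
    This is affine in z, and the value there is at least
      (1 + e (s L - |L+1|)) hbar(z).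
    A slack dl taken from the dilation absorbs the O(e^2) terms uniformly on the
    ball, including near its boundary. The volume derivative of this family of
    positions is s L - |L+1| - s d + <q,y>, so maximality of hbar gives
      s (L - d) + <q,y> <= |L + 1|    for all s >= 1 and |q| <= 1.
    Large s with q = 0 yields L <= d; then s = d+1 (if L >= -1) or s = d
    (if L < -1) yields (d+1) L + <q,y> <= (d+1)^2. *)

(** * Monotonicity, scaling and triangular substitution for the iterated integral *)

Section iterated_integral.
Set Implicit Arguments. Unset Strict Implicit.
Context {R : realType}.
Local Open Scope classical_set_scope.
Local Open Scope ereal_scope.
Local Notation mu := (@lebesgue_measure R).

Import HBNNSimple.

(* No measurability is assumed: the sections of the integrand of [iint] need not
   be measurable, and the integral of a non-negative function is in any case the
   supremum of the integrals of its simple minorants. *)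
Lemma le_integral_nonmeasurable (F G : R -> \bar R) :
  (forall t, 0 <= F t) -> (forall t, F t <= G t) ->
  \int[mu]_t F t <= \int[mu]_t G t.
Proof.
move=> F0 FG; have G0 t : 0 <= G t by exact: le_trans (FG t).
rewrite !ge0_integralTE//; apply: ereal_sup_le => _ [h /= hF <-].
by exists h => // t; exact: le_trans (FG t).
Qed.

Lemma integral_le_minorants (F : R -> \bar R) (M : \bar R) :
  (forall t, 0 <= F t) ->
  (forall h : R -> R, measurable_fun setT h -> (forall t, (0 <= h t)%R) ->
     (forall t, (h t)%:E <= F t) -> \int[mu]_t (h t)%:E <= M) ->
  \int[mu]_t F t <= M.
Proof.
move=> F0 hM; rewrite ge0_integralTE//; apply/ereal_supP => _ [h /= hF <-].
have := hM h; rewrite integral_nnsfun// patch_setT; apply => //.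
exact: (measurable_funPT h).
Qed.

Lemma integral_scale_le (k : R) (F : R -> \bar R) : (0 < k)%R ->
  (forall t, 0 <= F t) -> k%:E * \int[mu]_t F t <= \int[mu]_t (k%:E * F t).
Proof.
move=> k0 F0; rewrite muleC -lee_pdivlMr//.
apply: integral_le_minorants => // h mh h0 hF.
rewrite lee_pdivlMr// muleC -ge0_integralZl//=.
- apply: le_integral_nonmeasurable => t; last by rewrite lee_pmul2l// lte_fin.
  by rewrite mule_ge0 ?lee_fin// ltW.
- exact/measurable_EFinP.
- by move=> t _; rewrite lee_fin.
- by rewrite lee_fin ltW.
Qed.

Let affine (a c : R) : measurableTypeR R -> measurableTypeR R :=
  fun t => (a * t + c)%R.

Let measurable_affine (a c : R) : measurable_fun setT (affine a c).
Proof. by apply: measurable_funD => //; exact: measurable_funM. Qed.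

(** By uniqueness of Lebesgue measure, it suffices to compare both sides on intervals, whose
    preimages under the affine map are again intervals. *)
Lemma lebesgue_measure_affine (a c : R) (A : set R) : (0 < a)%R ->
  measurable A -> mu A = a%:E * pushforward mu (affine a c) A.
Proof.
move=> a0 mA.
have -> // := @lebesgue_measure_unique R (mscale (NngNum (ltW a0))
  (pushforward mu (affine a c))).
move=> _ [[x y]] _ <- /=; rewrite /mscale /= /pushforward /=.
rewrite [X in _ = _ * mu X](_ : _ =
    [set` `](x - c) / a, (y - c) / a]]%R)%classic; last first.
  apply/seteqP; split => t /=; rewrite !in_itv /= ltr_pdivrMr// ler_pdivlMr//;
    by rewrite ltrBlDr lerBrDr mulrC.
rewrite !lebesgue_measure_itv /= !lte_fin ltr_pM2r ?invr_gt0// ltrD2r.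
case: ifPn => _; last by rewrite mule0.
rewrite -!EFinB -EFinM; congr (_%:E); field; by rewrite gt_eqF.
Qed.

Lemma integral_affine (a c : R) (h : R -> R) : (0 < a)%R ->
  measurable_fun setT h -> (forall t, (0 <= h t)%R) ->
  \int[mu]_t (h t)%:E = a%:E * \int[mu]_t (h (a * t + c))%:E.
Proof.
move=> a0 mh h0; have mEh : measurable_fun setT (EFin \o h).
  exact/measurable_EFinP.
rewrite -(ge0_integral_pushforward (measurable_affine a c) mu measurableT mEh);
  last by move=> t _; rewrite lee_fin.
rewrite -(@ge0_integral_mscale _ _ _ _ _ measurableT (NngNum (ltW a0)))//=.
  by apply: eq_measure_integral => A mA _; exact: lebesgue_measure_affine.
by move=> t _; rewrite lee_fin.
Qed.

(** A measurable minorant of the substituted integrand, composed with the inverse affine map, is a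
    minorant of [F]; the exact substitution rule is applied to that minorant only. *)
Lemma integral_affine_le (a c : R) (F : R -> \bar R) : (0 < a)%R ->
  (forall t, 0 <= F t) ->
  a%:E * \int[mu]_t F (a * t + c)%R <= \int[mu]_t F t.
Proof.
move=> a0 F0; rewrite muleC -lee_pdivlMr//.
apply: integral_le_minorants => // h mh h0 hF.
rewrite lee_pdivlMr// muleC.
have aV0 : (0 < a^-1)%R by rewrite invr_gt0.
rewrite (integral_affine (- (c / a))%R aV0)// muleA -EFinM divff ?gt_eqF// mul1e.
apply: le_integral_nonmeasurable => t; first by rewrite lee_fin.
have := hF (a^-1 * t + - (c / a))%R.
by have -> : (a * (a^-1 * t + - (c / a)) + c = t)%R by field; rewrite gt_eqF.
Qed.

Lemma iint_ge0 (d : nat) (F : 'rV[R]_d -> \bar R) :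
  (forall x, 0 <= F x) -> 0 <= iint F.
Proof.
by elim: d F => [|d IH] F F0 //=; apply: integral_ge0 => t _; exact: IH.
Qed.

Lemma le_iint (d : nat) (F G : 'rV[R]_d -> \bar R) :
  (forall x, 0 <= F x) -> (forall x, F x <= G x) -> iint F <= iint G.
Proof.
elim: d F G => [|d IH] F G F0 FG //=.
apply: le_integral_nonmeasurable => t; first exact: iint_ge0.
exact: IH.
Qed.

Lemma iint_scale_le (d : nat) (k : R) (F : 'rV[R]_d -> \bar R) : (0 < k)%R ->
  (forall x, 0 <= F x) -> k%:E * iint F <= iint (fun x => k%:E * F x).
Proof.
move=> k0; elim: d F => [|d IH] F F0 //=.
apply: le_trans (integral_scale_le k0 _) _; first by move=> t; exact: iint_ge0.
apply: le_integral_nonmeasurable => t; last exact: IH.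
by rewrite mule_ge0 ?iint_ge0// lee_fin ltW.
Qed.

Lemma iint_gt0 (d : nat) (r k : R) (F : 'rV[R]_d -> \bar R) :
  (0 < r)%R -> (0 < k)%R -> (forall x, 0 <= F x) ->
  (forall x : 'rV[R]_d, (forall i, (`|x ord0 i| <= r)%R) -> k%:E <= F x) -> 0 < iint F.
Proof.
move=> r0 k0 F0 Fk; suff : (k * (r + r) ^+ d)%:E <= iint F.
  by apply: lt_le_trans; rewrite lte_fin mulr_gt0// exprn_gt0// addr_gt0.
elim: d F F0 Fk => [|d IH] F F0 Fk /=.
  by rewrite expr0 mulr1; apply: Fk => -[].
apply: (@le_trans _ _ (\int[mu]_t
   ((k * (r + r) ^+ d)%:E * (\1_([set` `[(- r)%R, r]]) t)%:E))).
  rewrite ge0_integralZl//=.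
  - rewrite integral_indic//= setIT lebesgue_measure_itv/= lte_fin.
    by rewrite ifT ?gtrN// opprK -EFinD -EFinM exprSr mulrA.
  - by apply/measurable_EFinP; exact: measurable_indic.
  - by rewrite lee_fin mulr_ge0// ?ltW// exprn_gt0// addr_gt0.
apply: le_integral_nonmeasurable => t.
  by rewrite mule_ge0// lee_fin// mulr_ge0// ?ltW// exprn_gt0// addr_gt0.
rewrite indicE; case: (boolP (t \in _)) => [|_]; last first.
  by rewrite mule0; exact: iint_ge0.
rewrite inE /= in_itv /= -ler_norml => tr; rewrite mule1; apply: IH => // x xr.
apply: Fk => i; rewrite mxE; case: splitP => j _ //.
by rewrite mxE.
Qed.

(** Induction on [d]: a one-dimensional substitution in the outer variable, then the induction
    hypothesis for the lower right block. This direction bounds the integral of a position from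
    below, which is what maximality of [hbar] is tested against. *)
Lemma iint_triangular_le (d : nat) (M : 'M[R]_d) (c : 'rV[R]_d)
    (F : 'rV[R]_d -> \bar R) :
  (forall i j : 'I_d, (j < i)%N -> M i j = 0%R) -> (forall i, (0 < M i i)%R) ->
  (forall x, 0 <= F x) ->
  (\prod_i M i i)%:E * iint (fun x => F (x *m M + c)%R) <= iint F.
Proof.
elim: d M c F => [|d IH] M c F Mtri Mpos F0 /=.
  rewrite big_ord0 mul1e le_eqVlt; apply/orP; left; apply/eqP.
  by congr F; apply/rowP => -[].
pose M' : 'M[R]_d := @drsubmx _ 1 d 1 d M.
pose r : 'rV[R]_d := @ursubmx _ 1 d 1 d M.
pose m := M ord0 ord0; pose c1 := c ord0 ord0.
pose c' : 'rV[R]_d := @rsubmx _ 1 1 d c.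
have M'E i j : M' i j = M (lift ord0 i) (lift ord0 j).
  by rewrite !mxE; congr (M _ _); apply: val_inj.
(* The first coordinate of the image depends on [t] alone, since the lower left block vanishes. The
   rest of the first row only translates the remaining coordinates by [t *: r]. *)
have affE t (y : 'rV[R]_d) :
  ((row_mx (\row_(j < 1) t) y : 'rV[R]_(1 + d)) *m M + c =
    row_mx (\row_(j < 1) (m * t + c1)) (y *m M' + (t *: r + c')))%R.
  rewrite -[M](@submxK _ 1 d 1 d) -[c](@hsubmxK _ 1 1 d) -/M' -/r -/c'.
  rewrite (@mul_row_block _ 1 1 d 1 d) (@add_row_mx _ 1 1 d).
  have -> : @dlsubmx _ 1 d 1 d M = 0%R.
    by apply/matrixP => i j; rewrite !mxE Mtri//= ord1.
  rewrite mulmx0 addr0; congr (@row_mx _ 1 1 d _ _).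
    apply/rowP => j; rewrite !mxE big_ord1 !mxE ord1 mulrC.
    have e0 (k : 'I_1) : lshift d k = ord0 by apply: val_inj; rewrite /= ord1.
    by rewrite !e0.
  rewrite addrCA addrA; congr (_ + _ + _)%R.
  by apply/rowP => j; rewrite !mxE big_ord1 !mxE.
have tri' (i j : 'I_d) : (j < i)%N -> M' i j = 0%R.
  by move=> ji; rewrite M'E Mtri// !lift0.
have pos' i : (0 < M' i i)%R by rewrite M'E.
have prod0 : (0 < \prod_i M' i i)%R by exact: prodr_gt0.
rewrite big_ord_recl -/m EFinM -muleA.
under eq_bigr do rewrite -M'E.
apply: le_trans (integral_affine_le c1 (Mpos ord0) _); last first.
  by move=> t; exact: iint_ge0.
rewrite lee_pmul2l//; last by rewrite lte_fin; exact: Mpos.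
apply: le_trans (integral_scale_le prod0 _) _.
  by move=> t; exact: iint_ge0.
apply: le_integral_nonmeasurable => t.
  by rewrite mule_ge0 ?iint_ge0// lee_fin ltW.
under [X in iint X]eq_fun do rewrite affE.
exact: (IH M' _ (fun y => F (row_mx (\row_(j < 1) (m * t + c1)) y))%R).
Qed.

End iterated_integral.

(** * Pointwise estimates for the perturbed height function *)

Section perturbation.
Set Implicit Arguments. Unset Strict Implicit.
Context {R : realType} {d : nat}.
Implicit Types (x y z q : 'rV[R]_d).

Lemma dotvC x y : dotv x y = dotv y x.
Proof. by apply: eq_bigr => i _; rewrite mulrC. Qed.

Lemma dotvDr x y z : dotv x (y + z) = dotv x y + dotv x z.
Proof. by rewrite -big_split; apply: eq_bigr => i _; rewrite mxE mulrDr. Qed.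

Lemma dotvZr x k y : dotv x (k *: y) = k * dotv x y.
Proof. by rewrite /dotv mulr_sumr; apply: eq_bigr => i _; rewrite mxE mulrCA. Qed.

Lemma dotvNr x y : dotv x (- y) = - dotv x y.
Proof. by rewrite -scaleN1r dotvZr mulN1r. Qed.

Lemma sqnorm_ge0 x : 0 <= sqnorm x.
Proof. by apply: sumr_ge0 => i _; rewrite -expr2 sqr_ge0. Qed.

Lemma sqnormD x y : sqnorm (x + y) = sqnorm x + 2 * dotv x y + sqnorm y.
Proof.
rewrite /sqnorm dotvDr (dotvC (x + y) x) (dotvC (x + y) y) !dotvDr (dotvC y x).
ring.
Qed.

Lemma sqnormZ k x : sqnorm (k *: x) = k ^+ 2 * sqnorm x.
Proof. by rewrite /sqnorm dotvZr dotvC dotvZr mulrA -expr2. Qed.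

Lemma dotv_norm_le1 x y : sqnorm x <= 1 -> sqnorm y <= 1 -> `|dotv x y| <= 1.
Proof.
move=> x1 y1; rewrite ler_norml.
have := sqnorm_ge0 (x + y); have := sqnorm_ge0 (x + (-1) *: y).
rewrite !sqnormD sqnormZ dotvZr => h1 h2; apply/andP; split; lra.
Qed.

Lemma coord_norm_le1 x i : sqnorm x <= 1 -> `|x ord0 i| <= 1.
Proof.
move=> x1; rewrite -(@ler_pXn2r _ 2)// ?nnegrE// expr1n -normrX ger0_norm ?sqr_ge0//.
apply: le_trans x1; rewrite /sqnorm /dotv (bigD1 i)//= expr2 lerDl.
by apply: sumr_ge0 => j _; rewrite -expr2 sqr_ge0.
Qed.

Lemma affine_image_bounded (N : 'M[R]_d) (c : 'rV[R]_d) :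
  exists C, forall z, sqnorm z <= 1 -> sqnorm (z *m N + c) <= C.
Proof.
exists (\sum_j (\sum_i `|N i j| + `|c ord0 j|) ^+ 2) => z z1.
apply: ler_sum => j _; rewrite -expr2 -real_normK ?num_real//.
rewrite ler_pXn2r ?nnegrE ?addr_ge0 ?sumr_ge0//.
rewrite !mxE; apply: le_trans (ler_normD _ _) _; rewrite lerD2r.
apply: le_trans (ler_norm_sum _ _ _) _; apply: ler_sum => i _.
by rewrite normrM ler_piMl// coord_norm_le1.
Qed.

Lemma hbar_ge0 x : 0 <= hbar x.
Proof. by rewrite /hbar; case: ifP => // _; exact: sqrtr_ge0. Qed.

Lemma hbar_le1 x : hbar x <= 1.
Proof.
rewrite /hbar; case: ifP => // x1.
by rewrite -[leRHS]sqrtr1 ler_wsqrtr// gerBl sqnorm_ge0.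
Qed.

Lemma hbar_gt0 x : (0 < hbar x) = (sqnorm x < 1).
Proof.
rewrite /hbar; case: ifPn => x1; first by rewrite sqrtr_gt0 subr_gt0.
by rewrite ltxx; apply/esym/negbTE; apply: contra x1; exact: ltW.
Qed.

Lemma ln_hbar x : sqnorm x < 1 -> 2 * ln (hbar x) = ln (1 - sqnorm x).
Proof.
move=> x1; have h0 : 0 < hbar x by rewrite hbar_gt0.
rewrite mulr_natl -lnXn//; congr ln.
by rewrite /hbar (ltW x1) sqr_sqrtr// subr_ge0 ltW.
Qed.

Lemma log_concave_ln (f : 'rV[R]_d -> R) x y t : log_concave f ->
  0 < f x -> 0 < f y -> 0 <= t <= 1 ->
  expR ((1 - t) * ln (f x) + t * ln (f y)) <= f ((1 - t) *: x + t *: y).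
Proof.
move=> lc fx fy t01; apply: le_trans (lc x y t t01).
by rewrite /powR !gt_eqF// expRD.
Qed.

(** The right side equals (1 - |z|^2)(1 - 2 e (s + dl)) + 2 e dl + t^2 - e^2 |V|^2. The term 2 e dl
    survives at |z| = 1 and pays for all quadratic errors, so the estimate is uniform up to the
    boundary. *)
Lemma hbar_perturbation (q z V : 'rV[R]_d) (s dl e C t : R) :
  sqnorm q <= 1 -> sqnorm z < 1 -> 1 <= s -> 0 < dl -> 0 < e ->
  dotv z V = - (s + dl) * sqnorm z - dotv q z -> sqnorm V <= C ->
  e * (s + 1) <= 1 / 2 ->
  e * (C + 2 * (s + 1) ^+ 2 + 4 * (s + dl) ^+ 2) <= 2 * dl ->
  t = e * (s + dotv q z) ->
  (1 - sqnorm z) * expR (- (2 * e * (s + dl)) + 2 * t ^+ 2) <=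
  (1 - t) ^+ 2 - sqnorm (z + e *: V).
Proof.
move=> q1 z1 s1 dl0 e0 zV VC es eC tE.
have := dotv_norm_le1 q1 (ltW z1); rewrite ler_norml => /andP[n1 n2].
rewrite sqnormD dotvZr sqnormZ zV.
have Z0 := sqnorm_ge0 z.
set Z := sqnorm z in z1 Z0 *; set n := dotv q z in n1 n2 tE *.
set W := sqnorm V in VC *.
(* As t <= e (s + 1), the exponent is at most -v; then exp(-v) <= 1/(1+v) <= 1 - v + v^2 for v >=
   0. *)
pose v := 2 * e * (s + dl) - 2 * (e * (s + 1)) ^+ 2.
have v0 : 0 <= v.
  rewrite /v; have : e * (s + 1) * (e * (s + 1)) <= e * (s + 1) * (1 / 2).
    by rewrite ler_wpM2l// mulr_ge0// ?ltW//; lra.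
  have : 0 <= e * (s - 1) by apply: mulr_ge0; lra.
  have : 0 < e * dl by rewrite mulr_gt0.
  nra.
have t2 : t ^+ 2 <= (e * (s + 1)) ^+ 2.
  rewrite tE ler_pXn2r ?nnegrE ?mulr_ge0 ?(ltW e0)//; [|lra|lra].
  by rewrite ler_wpM2l ?(ltW e0)//; lra.
have E1 : expR (- (2 * e * (s + dl)) + 2 * t ^+ 2) <= 1 - v + v ^+ 2.
  apply: (@le_trans _ _ (expR (- v))); first by rewrite ler_expR /v; lra.
  rewrite expRN; apply: (@le_trans _ _ (1 + v)^-1).
    by rewrite lef_pV2 ?posrE ?expR_gt0 ?expR_ge1Dx//; lra.
  rewrite -[leLHS]mul1r ler_pdivrMr; last lra.
  have : 0 <= v ^+ 3 by rewrite exprn_ge0.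
  by rewrite !exprS expr0; nra.
have v2 : v ^+ 2 <= 4 * e ^+ 2 * (s + dl) ^+ 2.
  rewrite (_ : _ * _ = (2 * e * (s + dl)) ^+ 2); last by ring.
  rewrite ler_pXn2r ?nnegrE//; first by rewrite /v lerBlDr lerDl mulr_ge0 ?sqr_ge0.
  by rewrite !mulr_ge0 ?(ltW e0)//; lra.
have E2 : expR (- (2 * e * (s + dl)) + 2 * t ^+ 2) <=
    1 - 2 * e * (s + dl) + e ^+ 2 * (2 * (s + 1) ^+ 2 + 4 * (s + dl) ^+ 2).
  by apply: le_trans E1 _; rewrite /v exprMn in v2 *; lra.
apply: (@le_trans _ _ ((1 - Z) *
    (1 - 2 * e * (s + dl) + e ^+ 2 * (2 * (s + 1) ^+ 2 + 4 * (s + dl) ^+ 2)))).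
  by rewrite ler_wpM2l ?subr_ge0 ?(ltW z1).
set D := 2 * (s + 1) ^+ 2 + 4 * (s + dl) ^+ 2.
have D0 : 0 <= D by rewrite /D addr_ge0// mulr_ge0 ?sqr_ge0.
have eC' : e * e * (C + D) <= e * (2 * dl).
  by rewrite -mulrA ler_wpM2l ?(ltW e0)// /D; lra.
have eW : e * e * W <= e * e * C by rewrite ler_wpM2l// mulr_ge0 ?(ltW e0).
have eZD : 0 <= e * e * Z * D by rewrite !mulr_ge0 ?(ltW e0).
have t20 := sqr_ge0 t.
rewrite -subr_ge0.
rewrite (_ : _ - _ = e * (2 * dl) - e * e * D + e * e * Z * D - e * e * W + t ^+ 2).
  lra.
by rewrite tE; ring.
Qed.

(** The point is (1 - t) w + t y with t = e (s + <q,z>), where w = (z + e V)/(1 - t) lies in the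
    open ball by the preceding estimate. Log-concavity and f(w) >= hbar(w) reduce the claim to an
    inequality between logarithms. *)
Lemma log_concave_perturbation (f : 'rV[R]_d -> R) (q y z V : 'rV[R]_d)
    (s dl e C L b : R) :
  log_concave f -> fle (@hbar R d) f -> 0 < f y ->
  sqnorm q <= 1 -> 1 <= s -> 0 < dl -> 0 < e ->
  dotv z V = - (s + dl) * sqnorm z - dotv q z ->
  (sqnorm z <= 1 -> sqnorm V <= C) ->
  e * (s + 1) <= 1 / 2 ->
  e * (C + 2 * (s + 1) ^+ 2 + 4 * (s + dl) ^+ 2) <= 2 * dl ->
  L = ln (f y) -> b = s * L - `|L + 1| - dl -> 0 < 1 + e * b ->
  (1 + e * b) * hbar z <= f (z + e *: V + (e * (s + dotv q z)) *: y).
Proof.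
move=> lc hf fy q1 s1 dl0 e0 zV VC es eC LE bE eb0.
have f0 x : 0 <= f x by apply: le_trans (hf x); exact: hbar_ge0.
have := hbar_ge0 z; rewrite le_eqVlt => /predU1P[<-|]; first by rewrite mulr0.
rewrite hbar_gt0 => z1; have {}VC := VC (ltW z1).
set t := e * (s + dotv q z).
have K := hbar_perturbation q1 z1 s1 dl0 e0 zV VC es eC (erefl t).
have := dotv_norm_le1 q1 (ltW z1); rewrite ler_norml => /andP[n1 n2].
have t0 : 0 <= t by rewrite /t mulr_ge0 ?(ltW e0)//; lra.
have t1 : t <= 1 / 2.
  apply: le_trans es; rewrite /t ler_wpM2l ?(ltW e0)//; lra.
have t1' : 0 < 1 - t by lra.
set N := sqnorm (z + e *: V) in K.
pose k2 := (1 - t) ^+ 2 - N.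
have N0 : 0 <= N by exact: sqnorm_ge0.
have Z1 : 0 < 1 - sqnorm z by rewrite subr_gt0.
have k0 : 0 < k2 by apply: lt_le_trans K; rewrite mulr_gt0 ?expR_gt0.
have k1 : k2 <= 1.
  rewrite /k2; have : (1 - t) ^+ 2 <= 1 by rewrite expr2; nra.
  lra.
pose w := (1 - t)^-1 *: (z + e *: V).
have wE : 1 - sqnorm w = k2 / (1 - t) ^+ 2.
  by rewrite /w sqnormZ -/N /k2; field; rewrite gt_eqF.
have w1 : sqnorm w < 1 by rewrite -subr_gt0 wE divr_gt0// exprn_gt0.
have hw0 : 0 < hbar w by rewrite hbar_gt0.
have fw0 : 0 < f w by apply: lt_le_trans (hf w).
have -> : z + e *: V = (1 - t) *: w by rewrite /w scalerA divff ?scale1r// gt_eqF.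
have t01 : 0 <= t <= 1 by rewrite t0/=; lra.
apply: le_trans (log_concave_ln lc fw0 fy t01).
have hz0 : 0 < hbar z by rewrite hbar_gt0.
rewrite -[leLHS]lnK ?posrE ?mulr_gt0// ler_expR lnM ?posrE//.
have lb := le_ln1Dx (_ : -1 < e * b).
have {}lb : ln (1 + e * b) <= e * b by apply: lb; lra.
apply: le_trans (lerD lb (lexx _)) _.
have lfw : ln (hbar w) <= ln (f w) by rewrite ler_ln ?posrE.
apply: (@le_trans _ _ ((1 - t) * ln (hbar w) + t * L)); last first.
  by rewrite -LE lerD2r ler_wpM2l// ltW.
have hwE := ln_hbar w1; have hzE := ln_hbar z1.
rewrite wE ln_div ?posrE ?exprn_gt0// lnXn// mulr2n in hwE.
have cE : ln (1 - t) <= - t by apply: le_ln1Dx; lra.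
have ka : ln (1 - sqnorm z) + (- (2 * e * (s + dl)) + 2 * t ^+ 2) <= ln k2.
  rewrite -[X in _ + X <= _]expRK -lnM ?posrE ?expR_gt0//.
  by rewrite ler_ln ?posrE// mulr_gt0// expR_gt0.
have a0 : ln k2 <= 0 by exact: ln_le0.
(* The 1 added to L comes from -(1 - t) ln(1 - t) >= t - t^2, and the absolute value from |<q,z>| <=
   1. The lost t^2 is returned by half of the 2 t^2 in the exponent of [ka]. *)
have tL : e * s * (L + 1) - e * `|L + 1| <= t * (L + 1).
  have -> : t * (L + 1) = e * s * (L + 1) + e * (dotv q z * (L + 1)).
    by rewrite /t; ring.
  rewrite lerD2l -mulrN ler_wpM2l ?(ltW e0)//.
  rewrite lerNl -mulNr; apply: le_trans (ler_norm _) _.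
  by rewrite normrM normrN ler_piMl// ler_norml n1.
set c := ln (1 - t) in cE hwE; set a := ln k2 in ka a0 hwE.
have h1 : 0 <= (1 - t) * (- t - c) by apply: mulr_ge0; lra.
have h2 : 0 <= t * (- a) by apply: mulr_ge0; lra.
have -> : ln (hbar w) = a / 2 - c by lra.
have -> : ln (hbar z) = ln (1 - sqnorm z) / 2 by lra.
rewrite bE.
move: (ln (1 - sqnorm z)) ka => Z' ka.
move: (`|L + 1|) tL => l tL.
nra.
Qed.

End perturbation.

(** * Volume comparison and the dual inequality *)

Section main.
Import numFieldNormedType.Exports.
Local Open Scope classical_set_scope.
Local Open Scope ring_scope.
Set Implicit Arguments. Unset Strict Implicit.
Context {R : realType}.

Lemma prod_1Dx_expansion (s : seq R) : exists2 C, 0 <= C &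
  forall e, 0 <= e <= 1 ->
    `|\prod_(a <- s) (1 + e * a) - 1 - e * \sum_(a <- s) a| <= C * e ^+ 2.
Proof.
elim: s => [|a s [C C0 IH]].
  exists 0 => // e _; rewrite !big_nil.
  by rewrite (_ : _ - _ - _ = 0) ?normr0 ?mul0r//; ring.
exists (C * (1 + `|a|) + `|a * \sum_(b <- s) b|) => [|e /andP[e0 e1]].
  by rewrite addr_ge0// mulr_ge0// addr_ge0.
have {}IH := IH e; rewrite e0 e1 in IH; have {}IH := IH isT.
rewrite !big_cons; set P := \prod_(b <- s) _ in IH *; set S := \sum_(b <- s) b in IH *.
rewrite (_ : _ - _ - _ = (P - 1 - e * S) * (1 + e * a) + e ^+ 2 * (a * S)); last ring.
apply: le_trans (ler_normD _ _) _.
rewrite [leRHS]mulrDl lerD//; last by rewrite normrM ger0_norm ?sqr_ge0// mulrC.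
rewrite normrM mulrAC ler_pM//.
apply: le_trans (ler_normD _ _) _; rewrite normr1 lerD2l normrM ger0_norm//.
by rewrite ler_piMl.
Qed.

(** The sum is the derivative of the product at e = 0. The product will be the height factor times
    the determinant of a perturbed position. *)
Lemma prod_1Dx_gt1_near (s : seq R) : 0 < \sum_(a <- s) a ->
  \forall e \near 0^'+, 1 < \prod_(a <- s) (1 + e * a).
Proof.
move=> S0; have [C C0 HC] := prod_1Dx_expansion s.
have r0 : 0 < (\sum_(a <- s) a) / (C + 1) by rewrite divr_gt0// ltr_wpDl.
near=> e.
have e0 : 0 < e by near: e; exact: nbhs_right_gt.
have e1 : e <= 1 by near: e; exact: nbhs_right_ltW.
have : e * (C + 1) < \sum_(a <- s) a.
  by rewrite -ltr_pdivlMr ?ltr_wpDl//; near: e; exact: nbhs_right_lt.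
have := HC e; rewrite (ltW e0) e1 => /(_ isT).
rewrite ler_norml => /andP[lb _] eC.
set S := \sum_(a <- s) a in lb eC *.
have : 0 < e * (S - e * (C + 1)) by rewrite mulr_gt0// subr_gt0.
have : 0 < e * e by rewrite mulr_gt0.
nra.
Unshelve. all: by end_near. Qed.

Context {d : nat}.
Implicit Types (q y z : 'rV[R]_d).

(* An upper triangular matrix with the same quadratic form as [q^T *m y]: the two
   differ by an antisymmetric matrix, that is, to first order by a rotation of the
   ball, and triangular maps only need one-dimensional changes of variables. *)
Definition upper_outer q y : 'M[R]_d := \matrix_(i, j)
  ((i <= j)%N%:R * (q ord0 i * y ord0 j) + (i < j)%N%:R * (q ord0 j * y ord0 i)).

Lemma dotv_upper_outer q y z :
  dotv z (z *m upper_outer q y) = dotv q z * dotv y z.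
Proof.
pose S i j := q ord0 i * z ord0 i * (y ord0 j * z ord0 j).
transitivity (\sum_(i < d) \sum_(j < d) ((j <= i)%N%:R * S j i + (j < i)%N%:R * S i j)).
  apply: eq_bigr => i _; rewrite mxE mulr_sumr; apply: eq_bigr => j _.
  by rewrite mxE /S; ring.
under eq_bigr do rewrite big_split/=.
(* Swapping the indices in the first half turns its range j <= i into i <= j, the complement of the
   range j < i of the second half. *)
rewrite big_split/= exchange_big/= -big_split/=.
rewrite /dotv mulr_suml; apply: eq_bigr => i _.
rewrite mulr_sumr -big_split; apply: eq_bigr => j _ /=.
rewrite -/(S i j) -mulrDl leqNgt.
by case: ltnP => _ /=; rewrite ?addr0 ?add0r mul1r.
Qed.

Lemma sum_diag_upper_outer q y : \sum_i upper_outer q y i i = dotv q y.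
Proof.
by apply: eq_bigr => i _; rewrite mxE leqnn ltnn mul1r mul0r addr0.
Qed.

Lemma integral_hbar_gt0 : (0 < integral_Rd (@hbar R d))%E.
Proof.
(* Since r <= 1, on the cube of half-side r one has |x|^2 <= d r^2 <= d r <= 1/2, hence [hbar] is at
   least 1/2 there. *)
pose r : R := (2 * d.+1%:R)^-1.
have r0 : 0 < r by rewrite invr_gt0 mulr_gt0.
apply: (iint_gt0 r0 (_ : 0 < 1 / 2)) => [|x|x xr]; first by lra.
  by rewrite lee_fin hbar_ge0.
have xn : sqnorm x <= 1 / 2.
  apply: (@le_trans _ _ (\sum_(i < d) r)).
    apply: ler_sum => i _; rewrite -expr2 -real_normK ?num_real//.
    have r1 : r <= 1.
      by rewrite invf_le1 ?mulr_gt0// -[leLHS]mul1r ler_pM// ler1n.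
    rewrite expr2 -[leRHS]mulr1 ler_pM//.
    exact: le_trans (xr i) r1.
  rewrite sumr_const card_ord -[r *+ d]mulr_natl /r ler_pdivrMr ?mulr_gt0//.
  by rewrite -[d.+1%:R]natr1; lra.
rewrite lee_fin /hbar ifT; last by lra.
apply: (@le_trans _ _ (Num.sqrt ((1 / 2) ^+ 2))).
  by rewrite sqrtr_sqr ger0_norm//; lra.
by rewrite ler_wsqrtr//; lra.
Qed.

(** Transporting k [hbar] by z -> z M + b gives a position below [f] whose integral is at least k
    det M times that of [hbar]. *)
Lemma John_position_le (f : 'rV[R]_d -> R) (M : 'M[R]_d) (b : 'rV[R]_d) (k : R) :
  proper_log_concave f -> hbar_is_John_function f ->
  (forall i j : 'I_d, (j < i)%N -> M i j = 0) -> (forall i, 0 < M i i) -> 0 < k ->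
  (forall z, k * hbar z <= f (z *m M + b)) ->
  k * \prod_i M i i <= 1.
Proof.
move=> [f0 _ _ /andP[_ foo]] [hf John] Mtri Mpos k0 zf.
have detM : \det M = \prod_i M i i.
  rewrite -det_tr det_trig; first by apply: eq_bigr => i _; rewrite mxE.
  by apply/forallP => i; apply/forallP => j; apply/implyP => ij; rewrite mxE Mtri.
have pM0 : 0 < \prod_i M i i by exact: prodr_gt0.
have uM : M \in unitmx by rewrite unitmxE detM unitfE gt_eqF.
pose A := invmx M; pose a := - (b *m A).
have posE z : position (@hbar R d) A k a (z *m M + b) = k * hbar z.
  by rewrite /position mulmxDl mulmxK// addrK.
have pf : fle (position (@hbar R d) A k a) f.
  move=> x; have -> : x = (x - b) *m A *m M + b by rewrite mulmxKV// subrK.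
  by rewrite posE.
have := John A k a; rewrite unitmx_inv => /(_ uM k0 pf) le1.
have pos0 x : (0 <= (position (@hbar R d) A k a x)%:E)%E.
  by rewrite lee_fin mulr_ge0 ?hbar_ge0// ltW.
have := le_trans (iint_triangular_le b Mtri Mpos pos0) le1.
under [X in iint X]eq_fun do rewrite posE EFinM.
have h0 (x : 'rV[R]_d) : (0 <= (hbar x)%:E)%E by rewrite lee_fin hbar_ge0.
have := iint_scale_le k0 h0.
have := integral_hbar_gt0; rewrite /integral_Rd.
(* The integral of [hbar] is finite because [hbar] lies below [f]; being positive too, it can be
   cancelled. *)
have := le_iint h0 (fun x => hf x : ((hbar x)%:E <= (f x)%:E)%E).
case: (iint _) => [I| |] //; last first.
  by rewrite leye_eq => /eqP E; move: foo; rewrite /integral_Rd E.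
move=> _; rewrite lte_fin => I0 le2 le3.
have pM0' : (0 <= (\prod_i M i i)%:E)%E by rewrite lee_fin ltW.
have := le_trans (lee_wpmul2l pM0' le2) le3.
by rewrite -!EFinM lee_fin mulrA ger_pMl// mulrC.
Qed.

(** If the bound failed by D > 0, a small e would give a position below [f] whose volume factor
    exceeds 1. *)
Lemma John_dual_bound (f : 'rV[R]_d -> R) (q y : 'rV[R]_d) (s : R) :
  proper_log_concave f -> hbar_is_John_function f ->
  0 < f y -> sqnorm q <= 1 -> 1 <= s ->
  s * (ln (f y) - d%:R) + dotv q y <= `|ln (f y) + 1|.
Proof.
move=> pf Jf fy q1 s1; rewrite leNgt; apply/negP.
set L := ln (f y) => Dlt.
pose D := s * L - `|L + 1| - s * d%:R + dotv q y.
have D0 : 0 < D by rewrite /D; move: Dlt; lra.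
(* The height factor and each of the d diagonal entries lose dl to first order, which leaves a gain
   D - (d + 1) dl = D/2 > 0. *)
pose dl := D / (2 * d.+1%:R).
have dl0 : 0 < dl by rewrite divr_gt0// mulr_gt0.
pose b := s * L - `|L + 1| - dl.
pose T := upper_outer q y - (s + dl)%:M.
pose N := T - q^T *m y.
have [C VC] := affine_image_bounded N (- q).
pose K := C + 2 * (s + 1) ^+ 2 + 4 * (s + dl) ^+ 2.
have C_ge0 : 0 <= C.
  apply: le_trans (VC 0 _); rewrite ?sqnorm_ge0// /sqnorm /dotv big1//.
  by move=> i _; rewrite mxE mul0r.
have K0 : 0 < K.
  have : 0 < (s + 1) ^+ 2 by rewrite exprn_gt0//; lra.
  by have := sqr_ge0 (s + dl); rewrite /K; lra.
pose diag := [seq T i i | i <- enum 'I_d].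
have Tii i : T i i = upper_outer q y i i - (s + dl).
  by rewrite /T [LHS]mxE [X in _ + X]mxE [X in - X]mxE eqxx mulr1n.
have sum0 : 0 < \sum_(a <- b :: diag) a.
  rewrite big_cons big_map big_enum/=.
  under eq_bigr do rewrite Tii.
  rewrite sumrB sum_diag_upper_outer sumr_const card_ord -mulr_natr.
  have -> : b + (dotv q y - (s + dl) * d%:R) = D - dl * d.+1%:R.
    by rewrite /D /b -[d.+1%:R]natr1; ring.
  have -> : dl * d.+1%:R = D / 2 by rewrite /dl invfM mulrA divfK ?pnatr_eq0.
  lra.
(* Each condition holds for all small positive e, so they hold together. *)
have [e [e0 es eK eb [eT ep]]] : exists e, [/\ 0 < e, e * (s + 1) <= 1 / 2,
    e * K <= 2 * dl, 0 < 1 + e * b & (forall i, 0 < 1 + e * T i i) /\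
    1 < \prod_(a <- b :: diag) (1 + e * a)].
  have pos1 (x : R) : \forall e \near 0^'+, 0 < 1 + e * x.
    have x0 : 0 < (1 + `|x|)^-1 by rewrite invr_gt0 ltr_pwDl.
    near=> e.
    have e0 : 0 < e by near: e; exact: nbhs_right_gt.
    have : e * (1 + `|x|) < 1.
      rewrite -ltr_pdivlMr ?ltr_pwDl// mul1r; near: e; exact: nbhs_right_lt.
    have : - (e * `|x|) <= e * x.
      by rewrite -mulrN ler_wpM2l ?(ltW e0)// lerNl -normrN ler_norm.
    lra.
  have posT : \forall e \near 0^'+, forall i, 0 < 1 + e * T i i.
    by apply: filter_forall => i; exact: pos1.
  apply: (@filter_ex _ (0^'+)).
  near=> e; split.
  - near: e; exact: nbhs_right_gt.
  - rewrite -ler_pdivlMr; last lra.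
    by near: e; apply: nbhs_right_ltW; rewrite !divr_gt0//; lra.
  - rewrite -ler_pdivlMr//.
    by near: e; apply: nbhs_right_ltW; rewrite divr_gt0// mulr_gt0.
  - near: e; exact: pos1.
  - split; first by near: e; exact: posT.
    near: e; exact: prod_1Dx_gt1_near.
pose M := 1%:M + e *: T.
have Mii i : M i i = 1 + e * T i i.
  by rewrite /M [LHS]mxE [X in X + _]mxE [X in _ + X]mxE eqxx.
have Mtri (i j : 'I_d) : (j < i)%N -> M i j = 0.
  move=> ji; rewrite !mxE.
  have -> : (i == j) = false by apply/negbTE; rewrite neq_ltn ji orbT.
  by rewrite leqNgt ji ltnNge (ltnW ji)/= !mulr0n; ring.
suff : (1 + e * b) * \prod_i M i i <= 1.
  apply/negP; rewrite -ltNge; move: ep; rewrite big_cons big_map big_enum/=.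
  by under eq_bigr do rewrite -Mii.
apply: (John_position_le (b := e *: (s *: y - q)) pf Jf Mtri) => //.
  by move=> i; rewrite Mii.
move=> z; pose V := z *m N - q.
have zT : z *m T = z *m upper_outer q y - (s + dl) *: z.
  by rewrite /T mulmxBr mul_mx_scalar.
have zqy : z *m (q^T *m y) = dotv q z *: y.
  rewrite mulmxA; have -> : z *m q^T = (dotv q z)%:M.
    apply/rowP => j; rewrite !mxE ord1 mulr1n; apply: eq_bigr => i _.
    by rewrite mxE mulrC.
  by rewrite mul_scalar_mx.
have VE : V = z *m upper_outer q y - (s + dl) *: z - dotv q z *: y - q.
  by rewrite /V /N mulmxBr zT zqy.
(* The term -<q,z> y inside V cancels the part of the pull towards y that is linear in z and not
   triangular. *)
have -> : z *m M + e *: (s *: y - q) =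
    z + e *: V + (e * (s + dotv q z)) *: y.
  rewrite /M mulmxDr mulmx1 -scalemxAr zT VE.
  by apply/rowP => j; rewrite !mxE; ring.
case: pf => _ _ lc _; case: Jf => hf _.
apply: (@log_concave_perturbation _ _ f q y z V s dl e C L b) => //.
- rewrite VE !dotvDr !dotvNr !dotvZr dotv_upper_outer (dotvC z y) (dotvC z q).
  by rewrite /sqnorm; ring.
- exact: VC.
Unshelve. all: by end_near. Qed.

End main.

Theorem theorem1p2 (R : realType) (d : nat) (f : 'rV[R]_d -> R) :
  proper_log_concave f -> hbar_is_John_function f ->
  fle (@hbar R d) f /\
  (forall x : 'rV[R]_d,
      expR (- (d.+1)%:R) * hbar ((d.+1)%:R *: x) <= polar f x).
Proof.
(* The lower bound on a real infimum needs a nonempty set: the origin is admissible, as f(0) >=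
   hbar(0) > 0. *)
move=> pf Jf; have [hf _] := Jf; split=> // x; apply: lb_le_inf.
  exists (expR (- dotv x 0) / f 0), 0 => //=; apply: lt_le_trans (hf 0).
  by rewrite hbar_gt0 /sqnorm /dotv big1// => i _; rewrite mxE mul0r.
move=> _ [y /= fy <-].
have [q1|q1] := leP (sqnorm (d.+1%:R *: x)) 1; last first.
  by rewrite /hbar (lt_geF q1) mulr0 divr_ge0 ?expR_ge0// ltW.
apply: (@le_trans _ _ (expR (- d.+1%:R))).
  by rewrite ler_piMr ?expR_ge0 ?hbar_le1.
rewrite ler_pdivlMr// -[X in _ * X <= _]lnK ?posrE// -expRD ler_expR.
(* This is ln f(y) + <x,y> <= d + 1 multiplied by d + 1, so that q = (d + 1) x ranges over the unit
   ball. *)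
suff : d.+1%:R * ln (f y) + dotv (d.+1%:R *: x) y <= d.+1%:R ^+ 2.
  rewrite (dotvC _ y) dotvZr -mulrDr expr2 ler_pM2l// (dotvC y); lra.
set q := d.+1%:R *: x in q1 *.
have q00 : sqnorm (0 : 'rV[R]_d) <= 1.
  by rewrite /sqnorm /dotv big1// => i _; rewrite mxE mul0r.
have dual s q' := @John_dual_bound R d f q' y s pf Jf fy.
set L := ln (f y) in dual *.
have Ld : L <= d%:R.
  rewrite leNgt; apply/negP => Ld.
  have Ld' : 0 < L - d%:R by rewrite subr_gt0.
  have d0 : (0 : R) <= d%:R by [].
  (* With q = 0 and s = k + 1 the left side of the dual bound is (L + 1) + (L - d) > L + 1, a
     contradiction. *)
  pose k := (L + 1) / (L - d%:R).
  have kE : k * (L - d%:R) = L + 1 by rewrite divfK// gt_eqF.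
  have k0 : 0 <= k by rewrite divr_ge0; lra.
  have := dual (k + 1) 0 q00; rewrite dotvC /dotv big1 => [|i _]; last first.
    by rewrite mxE mulr0.
  rewrite ger0_norm; last lra.
  move=> /(_ ltac:(lra)); rewrite mulrDl kE; lra.
have [L1|L1] := leP (-1) L.
  (* This gives (d + 1) L + <q,y> <= d (d + 1) + L + 1, and L <= d finishes. *)
  have := dual d.+1%:R q q1; rewrite ler1n => /(_ isT).
  rewrite ger0_norm; last by lra.
  by rewrite -[d.+1%:R]natr1; nra.
(* The choice s = d below requires d >= 1. For d = 0 the inner product is an empty sum and L < 0
   suffices. *)
have [d0|d_gt0] := posnP d.
  rewrite /dotv big1 => [|i _]; last first.
    by have := ltn_ord i; rewrite [X in (_ < X)%N]d0.
  have : 0 <= d.+1%:R ^+ 2 :> R by rewrite exprn_ge0.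
  have : 0 <= d.+1%:R * (- L) by rewrite mulr_ge0//; lra.
  lra.
have := dual d%:R q q1; rewrite ler1n => /(_ d_gt0).
rewrite ler0_norm; last by lra.
have : (0 : R) <= d%:R by [].
rewrite -[d.+1%:R]natr1; nra.
Qed.
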